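(* Let $a_U,a_E\ge 1$. Let $(\mathbb U^n)_{n\in\mathbb N}$ be closed convex subsets of $\mathbb H$, and let $(u_n)$, $(v_n)$ be computed by the refining subset FISTA algorithm, where $u_n\in\mathbb U^{n+1}$ for all $n\in\mathbb N$. Suppose there exists a (strictly) monotone increasing sequence of integers $n_k\ge1$, $k\in\mathbb N$, such that $$\tilde w_k:=u_{n_k-1}\in\mathbb U^{n_k}\cap\mathbb U^{n_k+1}\cap\dots\cap\mathbb U^{n_{k+1}-1}\qquad\text{for all }k\in\mathbb N.$$ If $(\tilde w_k)_{k\in\mathbb N}$ is an $(a_U,a_E)$-minimising sequence of $E$ with $a_U>1$ and $n_k^2\lesssim a_E^ka_U^{2k}$, then $$\min_{n\le N}E_0(u_n)=\min_{n\le N}E(u_n)-\inf_{u\in\mathbb H}E(u)\lesssim\frac1{N^{2(1-\kappa)}}\quad\text{uniformly for }N\in\mathbb N,\qquad\text{where }\kappa=\frac{\log a_U^2}{\log a_E+\log a_U^2}.$$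
   Context: Here $\mathbb N=\{0,1,2,\dots\}$. $\mathbb H$ is a real Hilbert space with inner product $\langle\cdot,\cdot\rangle$ and norm $\|\cdot\|$. $f:\mathbb H\to\mathbb R$ is convex and differentiable with $1$-Lipschitz gradient, $g:\mathbb H\to\mathbb R\cup\{+\infty\}$ is proper, convex and weakly lower semicontinuous, $E=f+g$ is bounded below, and $E_0(u)=E(u)-\inf_{\mathbb H}E$. It is not assumed that $E$ attains its infimum. For sequences, $a_n\lesssim b_n$ means there exist $C,N_0>0$ with $a_n\le Cb_n$ for all $n>N_0$. For $a_U,a_E\ge1$, a sequence $(\tilde w_k)_{k\in\mathbb N}$ in $\mathbb H$ is an $(a_U,a_E)$-minimising sequence of $E$ if $\|\tilde w_k\|\lesssim a_U^k$ and $E_0(\tilde w_k)\lesssim a_E^{-k}$. FISTA stepsize: a real sequence $(t_n)_{n\ge1}$ with $t_1=1$, $t_n\ge1$ and $\rho_n:=t_n^2-t_{n+1}^2+t_{n+1}\ge0$ for all $n\ge1$. Refining subset FISTA algorithm: given closed convex sets $\mathbb U^n\subset\mathbb H$ (each containing a point where $g$ is finite), $u_0\in\mathbb U^0$ and a FISTA stepsize, set $v_0=u_0$ and for $n=0,1,2,\dots$ $$\bar u_n=\Big(1-\tfrac1{t_{n+1}}\Big)u_n+\tfrac1{t_{n+1}}v_n,\qquad u_{n+1}=\operatorname*{argmin}_{u\in\mathbb U^{n+1}}\tfrac12\|u-\bar u_n+\nabla f(\bar u_n)\|^2+g(u),\qquad v_{n+1}=(1-t_{n+1})u_n+t_{n+1}u_{n+1}.$$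 *)

(* Defs.v *)
From HB Require Import structures.
From mathcomp Require Import all_boot all_order all_algebra.
From mathcomp Require Import sesquilinear.
From mathcomp Require Import all_classical all_reals all_analysis.

Set Implicit Arguments.
Unset Strict Implicit.
Unset Printing Implicit Defensive.

Import Order.TTheory GRing.Theory Num.Theory.
Import numFieldNormedType.Exports.

Local Open Scope classical_set_scope.
Local Open Scope ring_scope.

(* A real Hilbert space is a complete normed space [H] together with an inner
   product [dot : {dot H for idfun}] which induces the norm of [H]. *)
Definition induces_norm (R : realType) (H : completeNormedModType R)
    (dot : {dot H for idfun}) : Prop :=
  forall x : H, `|x| ^+ 2 = dot x x.

(* The coarsest topology on [H] making all the functionals [dot y] continuous:
   [dot] is read as the map [x |-> (y |-> dot y x)] into [R]^[H] with the
   topology of pointwise convergence. *)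
Definition weak_space (R : realType) (H : completeNormedModType R)
    (dot : {dot H for idfun}) : topologicalType :=
  initial_topology (fun x : H => (fun y : H => dot y x) : {ptws H -> R}).

Definition weakly_lower_semicontinuous (R : realType)
    (H : completeNormedModType R) (dot : {dot H for idfun})
    (g : H -> \bar R) : Prop :=
  lower_semicontinuous (g : weak_space dot -> \bar R).

Definition is_gradient (R : realType) (H : completeNormedModType R)
    (dot : {dot H for idfun}) (f : H -> R) (gradf : H -> H) : Prop :=
  forall x : H, differentiable f x /\
    forall h : H, 'd f x h = dot (gradf x) h.

Definition proper_function (R : realType) (T : Type) (g : T -> \bar R) : Prop :=
  (forall x, g x != -oo%E) /\ (exists x, g x \is a fin_num).

(* For functions that never take the value [-oo]; recall [0 * +oo = 0]. *)
Definition convex_efunction (R : realType) (V : lmodType R)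
    (g : V -> \bar R) : Prop :=
  forall (s : R) (x y : V), 0 <= s <= 1 ->
    (g (s *: x + (1 - s) *: y)%R <= s%:E * g x + (1 - s)%:E * g y)%E.

Definition energy (R : realType) (T : Type) (f : T -> R) (g : T -> \bar R)
    (x : T) : \bar R := ((f x)%:E + g x)%E.

Definition bounded_below (R : realType) (T : Type) (E : T -> \bar R) : Prop :=
  exists m : R, forall x, (m%:E <= E x)%E.

Definition energy_gap (R : realType) (T : Type) (E : T -> \bar R)
    (x : T) : \bar R := (E x - ereal_inf (range E))%E.

Definition lesssim (R : realType) (a b : nat -> \bar R) : Prop :=
  exists (C : R) (N0 : nat), [/\ 0 < C, (0 < N0)%N &
    forall n, (N0 < n)%N -> (a n <= C%:E * b n)%E].

Definition minimising_sequence (R : realType) (H : completeNormedModType R)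
    (E : H -> \bar R) (aU aE : R) (w : nat -> H) : Prop :=
  lesssim (fun k => `|w k|%:E) (fun k => (aU ^+ k)%:E) /\
  lesssim (fun k => energy_gap E (w k)) (fun k => (aE ^- k)%:E).

(* [t 0] is a dummy value. *)
Definition fista_stepsize (R : realType) (t : nat -> R) : Prop :=
  t 1%N = 1 /\
  forall n, (1 <= n)%N ->
    1 <= t n /\ 0 <= t n ^+ 2 - t n.+1 ^+ 2 + t n.+1.

Definition is_argmin (R : realType) (T : Type) (A : set T) (F : T -> \bar R)
    (x : T) : Prop :=
  A x /\ forall y, A y -> (F x <= F y)%E.

Definition refining_subset_fista (R : realType) (H : completeNormedModType R)
    (gradf : H -> H) (g : H -> \bar R) (U : nat -> set H) (t : nat -> R)
    (u v : nat -> H) : Prop :=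
  [/\ U 0%N (u 0%N), v 0%N = u 0%N &
    forall n,
      let ubar := (1 - (t n.+1)^-1) *: u n + (t n.+1)^-1 *: v n in
      is_argmin (U n.+1)
        (fun w => ((2^-1 * `|w - ubar + gradf ubar| ^+ 2)%:E + g w)%E)
        (u n.+1) /\
      v n.+1 = (1 - t n.+1) *: u n + t n.+1 *: u n.+1].

Definition min_upto (R : realType) (a : nat -> \bar R) (N : nat) : \bar R :=
  (\big[mine/+oo]_(n < N.+1) a n)%E.

(* Main.v *)
Require Import Defs.
From mathcomp Require Import all_boot all_order all_algebra.
From mathcomp Require Import sesquilinear.
From mathcomp Require Import all_classical all_reals all_analysis.
Import Order.TTheory GRing.Theory Num.Theory.
Import numFieldNormedType.Exports.
Local Open Scope classical_set_scope.
Local Open Scope ring_scope.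

(** The sequence [w k = u (n_ k).-1] consists of iterates of the algorithm, so
    the assumed decay [E0 (w k) <~ aE ^- k] bounds the minimum of [E0] over all
    iterates up to [(n_ k).-1]. What remains is to convert the geometric rate
    in [k] into an algebraic rate in [N]. An index [N] lies in exactly one
    window [n_ k <= N < n_ k.+1]; the left inequality puts [w k] among the
    first [N] iterates, and the right one together with the growth condition on
    [n_] gives [N ^ 2 <~ (aE * aU ^ 2) ^ (k + 1)].

    The exponent [1 - kappa = ln aE / (ln aE + ln (aU ^ 2))] is the logarithm
    of [aE] to base [aE * aU ^ 2] ([powR_ln_ratio]), so raising the last bound
    to the power [1 - kappa] gives [N ^ (2 (1 - kappa)) <~ aE ^ (k + 1)]. Hence
    [aE ^- k <~ N ^ (- 2 (1 - kappa))], where passing from [k + 1] to [k] costs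
    one factor [aE] in the constant ([geometric_to_algebraic_rate]).

    Subtracting [inf E] commutes with minima in the extended reals, since
    [inf E] is finite: [E] is bounded below and [g] is proper. *)

Section MinUpto.
Variable R : realType.
Local Open Scope ereal_scope.

Lemma min_upto_le (a : nat -> \bar R) (n N : nat) :
  (n <= N)%N -> min_upto a N <= a n.
Proof.
move=> nN; have nN1 : (n < N.+1)%N by [].
exact: (bigmin_le +oo (Ordinal nN1) (fun i : 'I_N.+1 => a i)).
Qed.

(** Finiteness of [c] matters for the default value of the empty minimum, which
    has to satisfy [+oo - c = +oo]. *)
Lemma min_uptoB (a : nat -> \bar R) (c : \bar R) (N : nat) :
  c \is a fin_num -> min_upto (fun n => a n - c) N = min_upto a N - c.
Proof.
move=> cfin; rewrite /min_upto.
rewrite (big_morph (fun x => x - c) (id1 := +oo) (op1 := mine)) //.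
  move=> x y; have [xy|/ltW yx] := leP x y.
    by rewrite min_l// leeD2r.
  by rewrite min_r// leeD2r.
by case: c cfin.
Qed.

Lemma ereal_inf_range_fin_num (T : Type) (E : T -> \bar R) :
  bounded_below E -> (exists x, E x \is a fin_num) ->
  ereal_inf (range E) \is a fin_num.
Proof.
move=> [m mE] [x Ex]; rewrite fin_numElt; apply/andP; split.
  apply: (@lt_le_trans _ _ m%:E); first exact: ltNyr.
  by apply/ereal_infP => _ [y _ <-].
apply: (@le_lt_trans _ _ (E x)); first by apply: ereal_inf_lbound; exists x.
by rewrite ltey_eq Ex.
Qed.

End MinUpto.

Lemma strictly_increasing_window (p : nat -> nat) (K N : nat) :
  {homo p : k l / (k < l)%N} -> (p K <= N)%N ->
  exists2 k, (K <= k)%N & (p k <= N < p k.+1)%N.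
Proof.
move=> p_incr pKN.
have id_le_p k : (k <= p k)%N.
  by elim: k => // k IH; apply: leq_ltn_trans IH (p_incr _ _ _).
have ex : exists k, (p k <= N)%N by exists K.
have ub k : (p k <= N)%N -> (k <= N)%N by exact/leq_trans/id_le_p.
case: (ex_maxnP ex ub) => k pkN k_max.
exists k; first exact: k_max.
by rewrite pkN ltnNge; apply/negP => /k_max; rewrite ltnn.
Qed.

Section Rate.
Variable R : realType.
Implicit Types a b : R.

(** The ratio is the logarithm of [a] to base [a * b]. *)
Lemma powR_ln_ratio a b : 1 <= a -> 1 < b ->
  (a * b) `^ (1 - ln b / (ln a + ln b)) = a.
Proof.
move=> a1 b1; have a0 : 0 < a by exact: lt_le_trans a1.
have b0 : 0 < b by exact: lt_trans b1.
have lab : ln a + ln b != 0.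
  by rewrite gt_eqF// ltr_wpDl ?ln_ge0 ?ln_gt0.
rewrite /powR gt_eqF ?mulr_gt0//= lnM ?posrE// mulrBl mul1r divfK// addrK.
by rewrite lnK ?posrE.
Qed.

(** Since [(a * b) ^ theta = a], the growth condition on [p] bounds
    [N ^ (2 * theta)] by a multiple of [a ^ (k + 1)] on the window
    [p k <= N < p k.+1], where the term of index [(p k).-1] has size
    [O (a ^- k)]. *)
Lemma geometric_to_algebraic_rate a b (e : nat -> \bar R) (p : nat -> nat) :
  1 <= a -> 1 < b -> {homo p : k l / (k < l)%N} ->
  lesssim (fun k => e (p k).-1) (fun k => (a ^- k)%:E) ->
  lesssim (fun k => ((p k)%:R ^+ 2)%:E) (fun k => ((a * b) ^+ k)%:E) ->
  lesssim (min_upto e)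
    (fun N => (1 / N%:R `^ (2 * (1 - ln b / (ln a + ln b))))%:E).
Proof.
move=> a1 b1 p_incr [C1 [K1 [C10 _ e_decay]]] [C2 [K2 [C20 _ p_growth]]].
have a0 : 0 < a by exact: lt_le_trans a1.
have b0 : 0 < b by exact: lt_trans b1.
have := powR_ln_ratio _ _ a1 b1.
set theta := 1 - _ => ab_theta.
have theta0 : 0 <= theta.
  rewrite /theta subr_ge0 ler_pdivrMr ?mul1r ?lerDr ?ln_ge0//.
  by rewrite ltr_wpDl ?ln_ge0 ?ln_gt0.
set K := (maxn K1 K2).+1.
exists (C1 * (C2 `^ theta * a)), (p K); split.
- by rewrite !mulr_gt0// powR_gt0.
- by rewrite (leq_ltn_trans (leq0n (p 0%N)))// p_incr.
move=> N pKN.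
have [k Kk /andP[pkN Npk]] := strictly_increasing_window _ _ _ p_incr (ltnW pKN).
have K1k : (K1 < k)%N by rewrite (leq_trans _ Kk)// ltnS leq_maxl.
have K2k : (K2 < k.+1)%N by rewrite ltnS ltnW// (leq_trans _ Kk)// ltnS leq_maxr.
have N0 : 0 < N%:R :> R by rewrite ltr0n (leq_ltn_trans _ pKN).
apply: le_trans (min_upto_le _ e _ _ (leq_trans (leq_pred _) pkN)) _.
apply: le_trans (e_decay k K1k) _.
rewrite -!EFinM lee_fin -mulrA ler_pM2l// mul1r.
rewrite ler_pdivlMr ?powR_gt0// mulrC ler_pdivrMr ?exprn_gt0//.
rewrite -mulrA -exprS powRrM powR_mulrn; last exact: ltW.
have -> : a ^+ k.+1 = ((a * b) ^+ k.+1) `^ theta.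
  rewrite -[(a * b) ^+ _]powR_mulrn ?mulr_ge0 ?ltW//.
  rewrite -powRrM [_ * theta]mulrC powRrM ab_theta.
  by rewrite powR_mulrn// ltW.
rewrite -powRM ?exprn_ge0 ?mulr_ge0 ?(ltW C20) ?(ltW a0) ?(ltW b0)//.
apply: ge0_ler_powR => //.
- by rewrite nnegrE exprn_ge0// ltW.
- by rewrite nnegrE mulr_ge0 ?exprn_ge0 ?mulr_ge0 ?(ltW C20) ?(ltW a0) ?(ltW b0).
have := p_growth _ K2k; rewrite -EFinM lee_fin; apply: le_trans.
by rewrite lerXn2r ?nnegrE// ler_nat ltnW.
Qed.

End Rate.

Theorem theorem3 (R : realType) (H : completeNormedModType R)
    (dot : {dot H for idfun}) (hdot : induces_norm dot)
    (f : H -> R) (gradf : H -> H) (g : H -> \bar R)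
    (f_convex : convex_function setT f)
    (f_grad : is_gradient dot f gradf)
    (gradf_lip : 1.-lipschitz gradf)
    (g_proper : proper_function g)
    (g_convex : convex_efunction g)
    (g_wlsc : weakly_lower_semicontinuous dot g)
    (E_bounded_below : bounded_below (energy f g))
    (aU aE : R) (aU_ge1 : 1 <= aU) (aE_ge1 : 1 <= aE)
    (U : nat -> set H)
    (U_closed : forall n, closed (U n))
    (U_convex : forall n, convex_set (U n))
    (U_dom : forall n, exists x, U n x /\ g x \is a fin_num)
    (t : nat -> R) (t_fista : fista_stepsize t)
    (u v : nat -> H) (uv_fista : refining_subset_fista gradf g U t u v)
    (u_next : forall n, U n.+1 (u n))
    (n_ : nat -> nat)
    (n_ge1 : forall k, (1 <= n_ k)%N)
    (n_incr : forall k l, (k < l)%N -> (n_ k < n_ l)%N)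
    (w_in : forall k m, (n_ k <= m < n_ k.+1)%N -> U m (u (n_ k).-1))
    (w_min : minimising_sequence (energy f g) aU aE (fun k => u (n_ k).-1))
    (aU_gt1 : 1 < aU)
    (n_growth : lesssim (fun k => ((n_ k)%:R ^+ 2)%:E)
                        (fun k => (aE ^+ k * aU ^+ (2 * k))%:E)) :
  let kappa := ln (aU ^+ 2) / (ln aE + ln (aU ^+ 2)) in
  (forall N,
     min_upto (fun n => energy_gap (energy f g) (u n)) N =
     (min_upto (fun n => energy f g (u n)) N
       - ereal_inf (range (energy f g)))%E) /\
  lesssim (min_upto (fun n => energy_gap (energy f g) (u n)))
          (fun N => (1 / (N%:R `^ (2 * (1 - kappa))))%:E).
Proof.
move=> kappa; split.
  move=> N; apply: min_uptoB; apply: ereal_inf_range_fin_num => //.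
  by have [_ [x gx]] := g_proper; exists x; rewrite /energy fin_numD gx.
apply: (@geometric_to_algebraic_rate R aE (aU ^+ 2) _ n_) => //.
- by rewrite exprn_egt1.
- exact: w_min.2.
by under [X in lesssim _ X]eq_fun do rewrite exprMn -exprM.
Qed.
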